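(* Let $X=\mathbb{P}^{1}$ be the Riemann sphere and $L=\mathcal{O}(1)$ its hyperplane line bundle. There exists an $S^{1}$-invariant geodesic $(\Phi_{t})_{t\in[0,1]}$ in $\mathcal{H}_{1,1}$ such that $t\mapsto\mathcal{M}(\Phi_{t})$ is affine, but $\Phi_{t}$ is not of the form $g(t)\Phi_{0}$ for a one-parameter subgroup $g(t)$ of the automorphism group $G$ of $(X,L)$.
   Context: $\mathcal{H}$ denotes the space of smooth metrics on $L$ with strictly positive curvature, and $\mathcal{H}_{1,1}$ the space of (singular) metrics $\Phi$ on $L$ with semi-positive curvature current $\omega_{\Phi}$ which is an $L^{\infty}$-form. On the affine chart $\mathbb{C}\subset\mathbb{P}^{1}$, a bounded metric is identified with a function $\Phi(z)$ with $\Phi-\log(1+|z|^{2})$ bounded, and $\omega_{\Phi}=\frac{i}{2\pi}\partial\bar\partial\Phi$; $\omega_{0}$ denotes the Fubini–Study form ($\Phi_{FS}=\log(1+|z|^{2})$). An $S^{1}$-invariant such metric corresponds to a convex function $\phi$ on $\mathbb{R}$ with $\Phi(z)=\phi(\log|z|^{2})$ and $\phi-\log(1+e^{x})$ bounded; its Legendre transform $u=\phi^{*}$, $u(y)=\sup_{x}(xy-\phi(x))$, is a bounded convex function on $[0,1]$. A curve $\Phi_{t}$ of $S^{1}$-invariant metrics is a geodesic (for the Mabuchi–Donaldson–Semmes metric) iff the corresponding Legendre transforms $u_{t}$ depend affinely on $t$. The K-energy $\mathcal{M}$ is defined on $\mathcal{H}_{1,1}$ (up to an additive constant) by the Chen–Tian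 formula $\mathcal{M}(\Phi)=\frac{\bar R}{n+1}\mathcal{E}(\Phi)-\mathcal{E}^{\mathrm{Ric}\,\omega_{0}}(\Phi)+\int_{X}\log\big(\omega_{\Phi}^{n}/\omega_{0}^{n}\big)\omega_{\Phi}^{n}$, where $n=\dim X$, $\bar R=n\,c_{1}(X)\cdot[\omega_{0}]^{n-1}/[\omega_{0}]^{n}$, and $\mathcal{E},\mathcal{E}^{\mathrm{Ric}\,\omega_{0}}$ are the functionals on $\mathcal{H}$ with differentials $d\mathcal{E}_{|\Phi}=(n+1)\omega_{\Phi}^{n}$ and $d\mathcal{E}^{\mathrm{Ric}\,\omega_{0}}_{|\Phi}=n\,\omega_{\Phi}^{n-1}\wedge\mathrm{Ric}\,\omega_{0}$, extended continuously in the $L^{\infty}$-norm. $g(t)\Phi_{0}$ denotes the pull-back of $\Phi_{0}$ under the flow of a holomorphic vector field on $X$ (a one-parameter subgroup of the automorphism group of $(X,L)$). *)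

(* Defs.v *)
From HB Require Import structures.
From mathcomp Require Import all_boot all_order all_algebra.
From mathcomp Require Import all_classical all_reals all_analysis.
From mathcomp Require Import complex.
Set Implicit Arguments. Unset Strict Implicit. Unset Printing Implicit Defensive.
Import Order.TTheory GRing.Theory Num.Theory.
Import numFieldNormedType.Exports.
Local Open Scope classical_set_scope.
Local Open Scope ring_scope.

(* X = P^1, L = O(1).  An S^1-invariant bounded metric Phi on L is encoded
   by the convex function phi on R with Phi(z) = phi(log |z|^2) on the
   affine chart C (z <> 0).  All quantities below live in the variable
   x = log |z|^2 after integrating out the S^1 angle. *)

Section P1.
Variable R : realType.

(* psi = Fubini-Study weight: psi x = log (1 + e^x);  Phi_FS(z) = log(1+|z|^2) *)
Definition psiFS (x : R) : R := ln (1 + expR x).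
Definition dpsiFS (x : R) : R := expR x / (1 + expR x).
(* density of omega_0 w.r.t. dx (d theta / 2 pi) *)
Definition d2psiFS (x : R) : R := expR x / (1 + expR x) ^+ 2.

(* phi corresponds to a metric in H_{1,1}: the curvature current
   omega_Phi (= the measure d(phi') in the variable x) is semi-positive
   (phi convex, phi' nondecreasing), has no atoms (phi differentiable) and is
   bounded by C * omega_0, i.e. it is an L^oo form; moreover
   Phi - Phi_FS is bounded. *)
Definition H11 (phi : R -> R) : Prop :=
  [/\ (forall x, derivable phi x 1),
      {homo (derive1 phi) : x y / x <= y},
      (exists C : R, forall a b, a <= b ->
           (derive1 phi) b - (derive1 phi) a <= C * (dpsiFS b - dpsiFS a))
    & (exists M : R, forall x, `|phi x - psiFS x| <= M)].

(* a.e. density of omega_Phi w.r.t. dx: phi'' where it exists, 0 elsewhere *)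
Definition d2 (phi : R -> R) (x : R) : R :=
  if `[< derivable (derive1 phi) x 1 >] then derive1 (derive1 phi) x else 0.

Definition legendre (phi : R -> R) (y : R) : R :=
  sup (range (fun x => x * y - phi x)).

(* integral over X of an S^1-invariant density, in the variable x *)
Definition intX (f : R -> R) : \bar R :=
  (\int[@lebesgue_measure R]_(x in [set: R]) (f x)%:E)%E.

(* n = dim X = 1 ;  Rbar = n c_1(X).[omega_0]^{n-1}/[omega_0]^n = 2 *)
Definition dimX : nat := 1.
Definition Rbar : R := 2.

(* Ric omega_0 = 2 omega_0 for the Fubini-Study form on P^1 *)
Definition ric_density (x : R) : R := 2 * d2psiFS x.

(* E(Phi) = int (Phi - Phi_0)(omega_Phi + omega_0), dE = 2 omega_Phi *)
Definition Efun (phi : R -> R) : \bar R :=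
  intX (fun x => (phi x - psiFS x) * (d2 phi x + d2psiFS x)).

(* E^{Ric omega_0}(Phi) = int (Phi - Phi_0) Ric omega_0, dE = Ric omega_0 *)
Definition ERicfun (phi : R -> R) : \bar R :=
  intX (fun x => (phi x - psiFS x) * ric_density x).

(* int log(omega_Phi/omega_0) omega_Phi, with 0 log 0 = 0 *)
Definition entropy (phi : R -> R) : \bar R :=
  intX (fun x => d2psiFS x * ((d2 phi x / d2psiFS x) * ln (d2 phi x / d2psiFS x))).

(* Chen-Tian formula for the K-energy *)
Definition Kenergy (phi : R -> R) : \bar R :=
  ((Rbar / (dimX.+1)%:R)%:E * Efun phi - ERicfun phi + entropy phi)%E.

Definition S1_geodesic (phi : R -> R -> R) : Prop :=
  (forall t, 0 <= t <= 1 -> H11 (phi t)) /\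
  (forall t y, 0 <= t <= 1 -> 0 <= y <= 1 ->
     legendre (phi t) y = (1 - t) * legendre (phi 0) y + t * legendre (phi 1) y).

Definition sqnorm (w : R[i]) : R := (complex.Re w) ^+ 2 + (complex.Im w) ^+ 2.

Definition ccont (f : R -> R[i]) : Prop :=
  continuous (fun t => complex.Re (f t)) /\ continuous (fun t => complex.Im (f t)).

(* one-parameter subgroup of Aut(X, L) = GL(2, C), acting linearly on C^2 *)
Definition one_param_subgroup (g : R -> 'M[R[i]]_2) : Prop :=
  [/\ g 0 = 1%:M,
      (forall s t, g (s + t) = g s *m g t)
    & (forall i j, ccont (fun t => g t i j))].

(* Phi = g^* Phi0 on the chart: for Z = g (1, z),
   (g^* Phi0)(z) = log|Z_0|^2 + Phi0(Z_1/Z_0), required at every z where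
   both sides are given by the S^1-invariant encoding (z <> 0, Z_0 <> 0,
   Z_1 <> 0; the remaining points form a finite set). *)
Definition pullback_eq (A : 'M[R[i]]_2) (phi phi0 : R -> R) : Prop :=
  forall z : R[i], z != 0 ->
    let Z0 := A 0 0 + A 0 1 * z in
    let Z1 := A 1 0 + A 1 1 * z in
    Z0 != 0 -> Z1 != 0 ->
    phi (ln (sqnorm z)) = ln (sqnorm Z0) + phi0 (ln (sqnorm (Z1 / Z0))).

End P1.

(* Main.v *)
Require Import Defs.
From HB Require Import structures.
From mathcomp Require Import all_boot all_order all_algebra.
From mathcomp Require Import all_classical all_reals all_analysis.
From mathcomp Require Import measurable_realfun complex.
From mathcomp Require Import ring lra.
Set Implicit Arguments. Unset Strict Implicit. Unset Printing Implicit Defensive.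
Import Order.TTheory GRing.Theory Num.Theory.
Import numFieldNormedType.Exports.
Local Open Scope classical_set_scope.
Local Open Scope ring_scope.

(* On the moment interval, the K-energy of a metric with Legendre transform
   [u] is [- int log u''] plus a term affine in [u], and it only sees the
   absolutely continuous part of [u'']. Hence adding [t * (y - 1/2)^+] to the
   Fubini-Study potential [u_0] gives a geodesic along which the K-energy is
   affine. Dually, the weight stops bending on an interval of length [t], and
   the relative entropy becomes [- 2 int (phi - psi) phi''], so that the K-energy
   is minus the Monge-Ampere energy [int (phi - psi) (phi'' + psi'')], which is
   [- t / 4]. The curvature vanishes on an annulus for [t > 0] but not for
   [t = 0], which no automorphism can achieve. *)

(** * The Fubini-Study weight, its derivatives and its limits *)

Section FubiniStudy.
Variable R : realType.
Implicit Types x y t : R.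
Local Notation psi := (@psiFS R).
Local Notation dpsi := (@dpsiFS R).
Local Notation d2psi := (@d2psiFS R).

Lemma psiFS_arg_gt0 x : 0 < 1 + expR x.
Proof. by rewrite addr_gt0 // expR_gt0. Qed.

Lemma expR_psiFS x : expR (psi x) = 1 + expR x.
Proof. by rewrite /psiFS lnK // posrE psiFS_arg_gt0. Qed.

(** Invariance of the Fubini-Study metric under [z -> 1/z]. It reduces negative arguments to
    positive ones and limits of differences at infinity to decaying terms. *)
Lemma psiFSN x : psi (- x) = psi x - x.
Proof.
apply: expR_inj; rewrite expRD !expR_psiFS expRN.
by have := expR_gt0 x; move=> ?; field; rewrite gt_eqF.
Qed.

Lemma psiFS_ge0 x : 0 <= psi x.
Proof. by rewrite -ler_expR expR0 expR_psiFS lerDl expR_ge0. Qed.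

Lemma psiFS_ge_id x : x <= psi x.
Proof. by have := psiFS_ge0 (- x); rewrite psiFSN; lra. Qed.

Lemma psiFS_lip x d : 0 <= d -> psi (x + d) <= psi x + d.
Proof.
move=> d0; rewrite -ler_expR expRD !expR_psiFS mulrDl mul1r -expRD lerD2r.
by rewrite -[X in X <= _]expR0 ler_expR.
Qed.

Lemma dpsiFSN x : dpsi (- x) = 1 - dpsi x.
Proof.
have e0 := expR_gt0 x; have e1 := psiFS_arg_gt0 x.
rewrite /dpsiFS expRN; field; rewrite !gt_eqF //.
Qed.

Lemma dpsiFS0 : dpsi 0 = 2^-1.
Proof. by rewrite /dpsiFS expR0 div1r. Qed.

Lemma dpsiFS_sub x y : dpsi y - dpsi x =
  (expR y - expR x) / ((1 + expR x) * (1 + expR y)).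
Proof.
have ex := psiFS_arg_gt0 x; have ey := psiFS_arg_gt0 y.
by rewrite /dpsiFS; field; rewrite !gt_eqF.
Qed.

Lemma ler_dpsiFS x y : x <= y -> dpsi x <= dpsi y.
Proof.
move=> xy; rewrite -subr_ge0 dpsiFS_sub divr_ge0 //.
by rewrite subr_ge0 ler_expR.
Qed.

Lemma d2psiFS_gt0 x : 0 < d2psi x.
Proof. by rewrite divr_gt0 ?expR_gt0 // exprn_gt0 // psiFS_arg_gt0. Qed.

(** The Einstein equation [Ric omega_0 = 2 omega_0] in potential form; it turns the entropy density
    into a difference of weights. *)
Lemma ln_d2psiFS x : ln (d2psi x) = x - 2 * psi x.
Proof.
have ex := psiFS_arg_gt0 x.
apply: expR_inj; rewrite lnK ?posrE ?d2psiFS_gt0 // expRB expRM_natl.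
by rewrite expR_psiFS.
Qed.

(** The logistic equation [psi'' = psi' (1 - psi')]. It makes [psi'^2] integrable in closed form,
    with primitive [psi - psi']. *)
Lemma dpsiFS_sqr x : dpsi x ^+ 2 = dpsi x - d2psi x.
Proof.
have ex := psiFS_arg_gt0 x.
by rewrite /dpsiFS /d2psiFS; field; rewrite gt_eqF.
Qed.

Global Instance is_derive_psiFS x : is_derive x 1 psi (dpsi x).
Proof.
have ex := psiFS_arg_gt0 x.
have -> : psi = @ln R \o (cst 1 + @expR R) by [].
apply: is_derive_eq.
  apply: is_derive1_comp.
  exact: is_derive1_ln.
by rewrite add0r mulrC.
Qed.

Global Instance is_derive_dpsiFS x : is_derive x 1 dpsi (d2psi x).
Proof.
have ex := psiFS_arg_gt0 x.
(* Writing [psi' = 1 - exp (- psi)] reduces the derivative to the chain rule. *)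
have -> : dpsi = cst 1 - (@expR R \o (- psi)).
  apply/funext => y; rewrite /dpsiFS /= !fctE expRN expR_psiFS.
  by have ey := psiFS_arg_gt0 y; field; rewrite gt_eqF.
apply: is_derive_eq.
rewrite /= !fctE expRN expR_psiFS /d2psiFS /dpsiFS.
by field; rewrite gt_eqF.
Qed.

Lemma continuous_psiFS : continuous psi.
Proof.
by move=> x; apply/differentiable_continuous/derivable1_diffP.
Qed.

Lemma continuous_dpsiFS : continuous dpsi.
Proof.
by move=> x; apply/differentiable_continuous/derivable1_diffP.
Qed.

Lemma continuous_d2psiFS : continuous d2psi.
Proof.
have -> : d2psi = dpsi - dpsi * dpsi.
  apply/funext => y; rewrite !fctE -expr2 dpsiFS_sqr; ring.
move=> x; apply: cvgB; first exact: continuous_dpsiFS.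
by apply: cvgM; exact: continuous_dpsiFS.
Qed.

Lemma cvg_psiFSN : psi (- x) @[x --> +oo] --> (0 : R).
Proof.
have e1 : 1 + expR (- x) @[x --> +oo] --> (1 : R).
  by rewrite -[X in _ --> X]addr0; apply: cvgD; [exact: cvg_cst|exact: cvgr_expR].
by rewrite -(ln1 R); apply: continuous_cvg e1; exact: continuous_ln.
Qed.

Lemma cvg_dpsiFS : dpsi x @[x --> +oo] --> (1 : R).
Proof.
have -> : dpsi = fun x => expR (- psi (- x)).
  apply/funext => x; rewrite expRN expR_psiFS /dpsiFS expRN.
  have e0 := expR_gt0 x; have e1 := psiFS_arg_gt0 x.
  by field; rewrite !gt_eqF.
rewrite -[X in _ --> X](@expR0 R) -[X in expR X]oppr0.
apply: continuous_cvg; first exact: continuous_expR.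
by apply: cvgN; exact: cvg_psiFSN.
Qed.

End FubiniStudy.

(** * The flattened weights and their elementary bounds *)

Section FlattenedWeight.
Variable R : realType.
Implicit Types x y t : R.
Local Notation psi := (@psiFS R).
Local Notation dpsi := (@dpsiFS R).
Local Notation d2psi := (@d2psiFS R).

(** For [t >= 0], this contracts [[0, t]] to the point [0] and translates what lies to its right.
    The slope of the flattened weight is [psi'] composed with this map. *)
Definition collapse t x : R := Num.min x 0 + Num.max (x - t) 0.

(* The Legendre transform of [flatFS t] is that of [psi] plus [t * (y - 1/2)^+]:
   the kink at [y = 1/2 = psi' 0] becomes an interval of length [t] on which
   the weight is affine. *)
Definition flatFS t x : R := psi (collapse t x) + (x - collapse t x) / 2.

Lemma collapse_left t x : 0 <= t -> x <= 0 -> collapse t x = x.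
Proof.
by move=> t0 x0; rewrite /collapse min_l // max_r ?addr0 //; lra.
Qed.

Lemma collapse_mid t x : 0 <= x -> x <= t -> collapse t x = 0.
Proof.
by move=> x0 xt; rewrite /collapse min_r // max_r ?addr0 //; lra.
Qed.

Lemma collapse_right t x : 0 <= t -> t <= x -> collapse t x = x - t.
Proof.
by move=> t0 xt; rewrite /collapse min_r ?max_l ?add0r //; lra.
Qed.

Lemma flatFS_left t x : 0 <= t -> x <= 0 -> flatFS t x = psi x.
Proof.
by move=> t0 x0; rewrite /flatFS collapse_left // subrr mul0r addr0.
Qed.

Lemma flatFS_mid t x : 0 <= x -> x <= t -> flatFS t x = psi 0 + x / 2.
Proof. by move=> x0 xt; rewrite /flatFS collapse_mid // subr0. Qed.

Lemma flatFS_right t x : 0 <= t -> t <= x ->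
  flatFS t x = psi (x - t) + t / 2.
Proof.
move=> t0 xt; rewrite /flatFS collapse_right //.
by congr (_ + _ / _); ring.
Qed.

Variant collapse_spec t x : R -> R -> Type :=
| CollapseLeft of x <= 0 : collapse_spec t x x (psi x)
| CollapseMid of 0 <= x & x <= t : collapse_spec t x 0 (psi 0 + x / 2)
| CollapseRight of t <= x : collapse_spec t x (x - t) (psi (x - t) + t / 2).

Lemma collapseP t x : 0 <= t -> collapse_spec t x (collapse t x) (flatFS t x).
Proof.
move=> t0; have [x0|/ltW x0] := leP x 0.
  by rewrite collapse_left // flatFS_left //; constructor.
have [xt|/ltW xt] := leP x t.
  by rewrite collapse_mid // flatFS_mid //; constructor.
by rewrite collapse_right // flatFS_right //; constructor.
Qed.

Lemma collapse_bounds t x : 0 <= t -> x - t <= collapse t x <= x.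
Proof. by move=> t0; case: (collapseP x t0); lra. Qed.

Lemma collapse_sub t x y : 0 <= t -> x <= y ->
  0 <= collapse t y - collapse t x <= y - x.
Proof.
by move=> t0 xy; case: (collapseP x t0); case: (collapseP y t0); lra.
Qed.

Lemma flatFS0 : flatFS 0 = psi.
Proof.
apply/funext => x; case: (collapseP x (lexx 0)) => // [x0 x0'|x0].
  have -> : x = 0 by lra.
  by rewrite mul0r addr0.
by rewrite subr0 mul0r addr0.
Qed.

(* This is [(p - 1) (e^c p - 1) >= 0] with [p = e^(d/2)]. *)
Lemma psiFS_midpoint c d : 0 <= c -> 0 <= d -> psi c + d / 2 <= psi (c + d).
Proof.
move=> c0 d0; rewrite -ler_expR expRD !expR_psiFS.
have -> : c + d = c + d / 2 + d / 2 by lra.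
rewrite !expRD.
have : 1 <= expR c by rewrite -[X in X <= _](@expR0 R) ler_expR.
have : 1 <= expR (d / 2) by rewrite -[X in X <= _](@expR0 R) ler_expR; lra.
set p := expR (d / 2); set e := expR c; move=> p1 e1.
have : 0 <= (p - 1) * (e * p - 1) by rewrite mulr_ge0 // subr_ge0 //; nra.
by lra.
Qed.

(** Flattening inserts a stretch of slope [1/2] at [0], and right of [0] the slope of [psi] is at
    least [1/2]. *)
Lemma flatFS_le t x : 0 <= t -> flatFS t x <= psi x.
Proof.
move=> t0; case: (collapseP x t0) => // [x0 xt|tx].
  by have := psiFS_midpoint (lexx 0) x0; rewrite add0r.
have := @psiFS_midpoint (x - t) t; rewrite subrK; apply => //; lra.
Qed.

Lemma flatFS_ge t x : 0 <= t -> psi x - t <= flatFS t x.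
Proof.
move=> t0; have /andP[c1 c2] := collapse_bounds x t0.
have := @psiFS_lip R (collapse t x) (x - collapse t x).
rewrite [X in psi X]addrC subrK subr_ge0 /flatFS => /(_ c2); lra.
Qed.

Lemma psiFS_tangent x : psi 0 + x / 2 <= psi x.
Proof.
have [x0|x0] := leP 0 x; first by have := psiFS_midpoint (lexx 0) x0; rewrite add0r.
have : 0 <= - x by lra.
by move=> /(psiFS_midpoint (lexx 0)); rewrite add0r psiFSN; lra.
Qed.

(** * Differentiability and membership in [H11] *)

Lemma is_derive_min0 (k dk : R -> R) x : (forall y, is_derive y 1 k (dk y)) ->
  dk 0 = 0 -> is_derive x 1 (fun y => k (Num.min y 0)) (dk (Num.min x 0)).
Proof.
move=> kd dk0; have [x0|x0|->] := ltgtP x 0.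
- apply: near_eq_is_derive (kd x); near=> y.
  by rewrite min_l // ltW //; near: y; exact: lt_nbhsl.
- rewrite dk0; apply: (@near_eq_is_derive _ _ _ (cst (k 0))); near=> y.
  by rewrite min_r // ltW //; near: y; exact: lt_nbhsr.
- rewrite dk0; apply/is_derive1_caratheodory.
  have /is_derive1_caratheodory[g [kg gc g0]] := kd 0.
  (* The Caratheodory slope [g] of [k] at [0] vanishes there, as [0] is a critical point, so
     truncating its argument gives a slope for the truncated function. *)
  exists (fun z => g (Num.min z 0)); split.
  + move=> z; rewrite minxx kg.
    have [z0|z0] := leP z 0; first by [].
    by rewrite g0 dk0 !mul0r.
  + apply: continuous_comp => /=; last by rewrite minxx.
    by apply: continuous_min; [exact: cvg_id|exact: cvg_cst].
  + by rewrite minxx g0.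
Unshelve. all: by end_near. Qed.


Lemma is_derive_flatFS t x : 0 <= t ->
  is_derive x 1 (flatFS t) (dpsi (collapse t x)).
Proof.
(* Removing the slope [1/2] makes [0] a critical point. Since [k] is even, both ends of the flat
   interval become truncations by [min]. *)
move=> t0; pose k y := psi y - y / 2; pose dk y := dpsi y - 2^-1.
have dkE y : is_derive y 1 k (dk y).
  have -> : k = psi - (2^-1 \*: id) by apply/funext => z; rewrite /k !fctE /= mulrC.
  by apply: is_derive_eq; rewrite /dk [_ *: _]mulr1.
have dk0 : dk 0 = 0 by rewrite /dk dpsiFS0 subrr.
have kN y : k (- y) = k y by rewrite /k psiFSN; lra.
have -> : flatFS t = (fun y => k (Num.min y 0)) +
    ((fun y => k (Num.min y 0)) \o (cst t - id)) + (2^-1 \*: id - cst (k 0)).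
  apply/funext => y; rewrite !fctE /= -[k (Num.min (t - y) 0)]kN.
  rewrite oppr_min opprB oppr0 /k /flatFS /collapse.
  have [y0|y0] := leP y 0; have [yt|yt] := leP (y - t) 0;
    by rewrite ?add0r ?addr0 /GRing.scale /=; lra.
apply: is_derive_eq.
  apply: is_deriveD; first apply: is_deriveD.
  - exact: is_derive_min0.
  - apply: is_derive1_comp; exact: is_derive_min0.
have -> : dk (Num.min (t - x) 0) = - dk (Num.max (x - t) 0).
  by rewrite -[Num.min _ _]opprK oppr_min opprB oppr0 /dk dpsiFSN; lra.
rewrite /= /dk /collapse [_ *: _]mulr1.
have [x0|x0] := leP x 0; have [xt|xt] := leP (x - t) 0;
  by rewrite ?add0r ?addr0 ?dpsiFS0; lra.
Qed.

Lemma derive1_flatFS t x : 0 <= t -> derive1 (flatFS t) x = dpsi (collapse t x).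
Proof.
by move=> t0; rewrite derive1E; have := is_derive_flatFS x t0 => -[].
Qed.

Lemma H11_flatFS t : 0 <= t -> H11 (flatFS t).
Proof.
move=> t0; split.
- by move=> x; have [] := is_derive_flatFS x t0.
- move=> x y xy; rewrite !derive1_flatFS //; apply: ler_dpsiFS.
  by have := collapse_sub t0 xy; lra.
(* In the quotient formula for increments of [psi'], collapsing does not increase the numerator and
   shrinks each of the two denominator factors by at most [e^t]. *)
- exists (expR (2 * t)) => x y xy; rewrite !derive1_flatFS // !dpsiFS_sub.
  have /andP[x1 x2] := collapse_bounds x t0.
  have /andP[y1 y2] := collapse_bounds y t0.
  have /andP[d1 d2] := collapse_sub t0 xy.
  have px := psiFS_arg_gt0 x; have py := psiFS_arg_gt0 y.
  have pX := psiFS_arg_gt0 (collapse t x); have pY := psiFS_arg_gt0 (collapse t y).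
  have num : expR (collapse t y) - expR (collapse t x) <= expR y - expR x.
    have eE u v : expR u - expR v = expR v * (expR (u - v) - 1) :> R.
      by rewrite mulrBr -expRD mulr1 [v + _]addrC subrK.
    rewrite !eE ler_pM ?expR_ge0 ?ler_expR //.
      by rewrite subr_ge0 -[X in X <= _](@expR0 R) ler_expR.
    by rewrite lerD2r ler_expR.
  have den z : 1 + expR z <= expR t * (1 + expR (collapse t z)).
    rewrite mulrDr mulr1 -expRD lerD //.
      by rewrite -[X in X <= _](@expR0 R) ler_expR.
    by rewrite ler_expR; have := collapse_bounds z t0; lra.
  have ratio : 1 <= expR (2 * t) *
      ((1 + expR (collapse t x)) * (1 + expR (collapse t y))) /
      ((1 + expR x) * (1 + expR y)).
    rewrite ler_pdivlMr ?mulr_gt0 // mul1r expRM_natl expr2 mulrACA.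
    by rewrite ler_pM // ltW.
  rewrite ler_pdivrMr ?mulr_gt0 //; apply: le_trans num _.
  rewrite [leRHS](_ : _ = (expR y - expR x) * (expR (2 * t) *
      ((1 + expR (collapse t x)) * (1 + expR (collapse t y))) /
      ((1 + expR x) * (1 + expR y)))); last by ring.
  by rewrite ler_peMr // subr_ge0 ler_expR.
- exists t => x; rewrite ler_norml.
  by have := flatFS_le x t0; have := flatFS_ge x t0; lra.
Qed.

(** * Legendre transforms *)

Lemma has_sup_legendre_psiFS y : 0 <= y <= 1 ->
  has_sup (range (fun x => x * y - psi x)).
Proof.
move=> /andP[y0 y1]; split; first by exists (0 * y - psi 0), 0.
exists 0 => _ [x _ <-].
by have := psiFS_ge0 x; have := psiFS_ge_id x; have [x0|x0] := leP 0 x; nra.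
Qed.

(** Domination of values in both directions compares the suprema without computing any maximiser. *)
Lemma sup_range_shift (f g : R -> R) c : has_sup (range f) ->
  (forall x, exists x', f x + c <= g x') -> (forall x, exists x', g x <= f x' + c) ->
  sup (range g) = sup (range f) + c.
Proof.
move=> sf fg gf.
have gub : ubound (range g) (sup (range f) + c).
  move=> _ [x _ <-]; have [x' h] := gf x; apply: le_trans h _.
  by rewrite lerD2r; apply: ub_le_sup; [exact: sf.2|exists x'].
have sg : has_sup (range g).
  have [_ [x _ _]] := sf.1.
  by split; [exists (g x), x|exists (sup (range f) + c)].
apply/eqP; rewrite eq_le; apply/andP; split.
  by apply: ge_sup => //; exact: sg.1.
rewrite -lerBrDr; apply: ge_sup; first exact: sf.1.
move=> _ [x _ <-]; have [x' h] := fg x; rewrite lerBrDr; apply: le_trans h _.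
by apply: ub_le_sup; [exact: sg.2|exists x'].
Qed.

(** For [y <= 1/2] points [x <= 0] suffice, and there the weights agree. For [y > 1/2] points
    [x >= 0] suffice for [psi], and shifting them by [t] gains [t * (y - 1/2)]. The tangent at [0]
    disposes of all other points. *)
Lemma legendre_flatFS t y : 0 <= t -> 0 <= y <= 1 ->
  legendre (flatFS t) y = legendre psi y + t * Num.max (y - 2^-1) 0.
Proof.
move=> t0 y01; apply: sup_range_shift; first exact: has_sup_legendre_psiFS.
  move=> x; have tx := psiFS_tangent x; have [yh|yh] := leP (y - 2^-1) 0.
    exists (Num.min x 0).
    by have [x0|x0] := leP x 0; rewrite flatFS_left //; nra.
  exists (Num.max x 0 + t).
  by have [x0|x0] := leP x 0; rewrite flatFS_right ?addrK; nra.
move=> x; have txt := psiFS_tangent (x - t); have [yh|yh] := leP (y - 2^-1) 0.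
  exists (Num.min x 0).
  have [x0|x0] := leP x 0; first by rewrite flatFS_left //; lra.
  by case: (collapseP x t0) => *; nra.
exists (Num.max (x - t) 0).
have [x0|/ltW x0] := leP (x - t) 0; last by rewrite flatFS_right; nra.
have := psiFS_tangent x.
have [x1|/ltW x1] := leP x 0; first by rewrite flatFS_left //; nra.
by rewrite flatFS_mid; nra.
Qed.

End FlattenedWeight.

(** * Curvature densities and explicit energy integrals *)

Section Energy.
Variable R : realType.
Implicit Types x y t : R.
Local Notation psi := (@psiFS R).
Local Notation dpsi := (@dpsiFS R).
Local Notation d2psi := (@d2psiFS R).
Local Notation mu := (@lebesgue_measure R).

Lemma d2_near (f g : R -> R) x l : (\forall y \near x, g y = derive1 f y) ->
  is_derive x 1 g l -> d2 f x = l.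
Proof.
move=> fg gl; have [df dfE] : is_derive x 1 (derive1 f) l.
  exact: near_eq_is_derive gl.
by rewrite /d2 asboolT // derive1E.
Qed.

(** A manifestly measurable representative of [d2 (flatFS t)], equal to it away from the break
    points [0] and [t]. *)
Definition curvature t x : R :=
  if 0 <= x <= t then 0 else d2psi (collapse t x).

Lemma curvature_ge0 t x : 0 <= curvature t x.
Proof. by rewrite /curvature; case: ifP => // _; rewrite ltW // d2psiFS_gt0. Qed.

Lemma d2_flatFS t x : 0 <= t -> x != 0 -> x != t ->
  d2 (flatFS t) x = curvature t x.
Proof.
move=> t0 x0 xt; rewrite /curvature.
have [xl|xl] := ltP x 0.
  rewrite /= (collapse_left t0 (ltW xl)).
  apply: (@d2_near _ dpsi); near=> y.
  rewrite derive1_flatFS // collapse_left // ltW //.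
  by near: y; exact: lt_nbhsl.
have [xr|xr] := leP x t.
  have xp : 0 < x by rewrite lt_def x0.
  have xtt : x < t by rewrite lt_neqAle xt.
  apply: (@d2_near _ (cst (dpsi 0))); near=> y.
  rewrite derive1_flatFS // collapse_mid // ltW //.
  - by near: y; exact: lt_nbhsr.
  - by near: y; exact: lt_nbhsl.
rewrite /= (collapse_right t0 (ltW xr)).
apply: (@d2_near _ (dpsi \o (id - cst t))); last first.
  by apply: is_derive_eq; rewrite subr0 mulr1.
near=> y; rewrite derive1_flatFS // collapse_right // ltW //.
by near: y; exact: lt_nbhsr.
Unshelve. all: by end_near. Qed.

(** Measurability is assumed for [g] and transferred to [f]: in the applications [f] involves [d2],
    which branches on differentiability. *)
Lemma intX_eq_off2 (a b : R) (f g : R -> R) : measurable_fun [set: R] g ->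
  (forall x, x != a -> x != b -> f x = g x) -> intX f = intX g.
Proof.
move=> mg fg.
have ms (c : R) : measurable [set c] by exact: measurable_set1.
have mN : measurable ([set a] `|` [set b]) by exact: measurableU.
have mf : measurable_fun [set: R] f.
  rewrite -(setUv ([set a] `|` [set b])).
  apply/measurable_funU => //; first exact: measurableC.
  split.
    by apply/measurable_funU => //; split; exact: measurable_fun_set1.
  apply: (@eq_measurable_fun _ _ _ _ _ g) => [x|].
    rewrite inE /= => /not_orP[xa xb]; rewrite fg //; exact/eqP.
  exact: measurable_funS mg.
apply: ae_eq_integral => //.
- exact/measurable_EFinP.
- exact/measurable_EFinP.
exists ([set a] `|` [set b]); split => //.
  by rewrite measureU0 //; exact: lebesgue_measure_set1.
move=> x /= /not_implyP[_]; apply: contra_notP => /not_orP[xa xb].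
by rewrite fg //; exact/eqP.
Qed.

Lemma measurable_curvature t : measurable_fun [set: R] (curvature t).
Proof.
apply: measurable_fun_ifT => //.
  by apply: measurable_and; exact: measurable_fun_ler.
have mc : measurable_fun [set: R] (collapse t).
  apply: measurable_funD; first exact: measurable_minr.
  by apply: measurable_maxr => //; exact: measurable_funB.
exact: measurableT_comp (continuous_measurable_fun (@continuous_d2psiFS R)) mc.
Qed.

Lemma measurable_flatFS t : 0 <= t -> measurable_fun [set: R] (flatFS t).
Proof.
move=> t0; apply: continuous_measurable_fun => x.
by apply/differentiable_continuous/derivable1_diffP; have [] := is_derive_flatFS x t0.
Qed.

(** The energy density [(psi - phi) (phi'' + psi'')] on the flat interval, where [phi'' = 0]. *)
Definition mid_energy x := (psi x - (psi 0 + x / 2)) * d2psi x.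

Lemma integral_mid_energy t : 0 <= t ->
  (\int[mu]_(x in `[0%R, t]) (mid_energy x)%:E)%E =
  ((psi t - psi 0 - t / 2) * (2^-1 + dpsi t) + t / 4 - psi t + dpsi t
    + psi 0 - 2^-1)%:E.
Proof.
(* Integration by parts: with [h = psi - phi], a primitive is [h (phi' + psi')] minus a primitive of
   [psi'^2 - phi'^2]; here [phi' = 1/2]. *)
move=> t0; pose G : R -> R := (psi - cst (psi 0) - (2^-1 \*: id)) * (cst 2^-1 + dpsi)
  + (4^-1 \*: id) - psi + dpsi.
have dG x : is_derive x 1 G (mid_energy x).
  apply: is_derive_eq; rewrite !fctE /= /mid_energy /GRing.scale /=.
  have := dpsiFS_sqr x; rewrite expr2; lra.
have GE x : G x = (psi x - psi 0 - x / 2) * (2^-1 + dpsi x) + x / 4 - psi x + dpsi x.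
  by rewrite /G !fctE /= /GRing.scale /=; lra.
have cG : continuous G.
  by move=> x; apply/differentiable_continuous/derivable1_diffP.
have cf : continuous mid_energy.
  move=> x; apply: cvgM; last exact: continuous_d2psiFS.
  apply: cvgB; first exact: continuous_psiFS.
  apply: cvgD; first exact: cvg_cst.
  by apply: cvgMl; exact: cvg_id.
have [->|tn0] := eqVneq t 0.
  rewrite set_itv1 integral_set1 dpsiFS0; congr EFin; lra.
have tp : 0 < t by rewrite lt_def tn0.
rewrite (@continuous_FTC2 _ mid_energy G) //.
- rewrite -EFinB !GE dpsiFS0; congr EFin; lra.
- exact: continuous_subspaceT.
- split.
  + by move=> x _.
  + exact/cvg_at_right_filter/cG.
  + exact/cvg_at_left_filter/cG.
- by move=> x _; rewrite derive1E derive_val.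
Qed.

(** The same density to the right of [t], where [phi] is a translate of [psi] plus a constant. *)
Definition right_energy t x :=
  (psi x - (psi (x - t) + t / 2)) * (d2psi (x - t) + d2psi x).

Lemma continuous_right_energy t : continuous (right_energy t).
Proof.
have cs : continuous (fun x => x - t).
  by move=> x; apply: cvgB; [exact: cvg_id|exact: cvg_cst].
move=> x; apply: cvgM.
  apply: cvgB; first exact: continuous_psiFS.
  apply: cvgD; last exact: cvg_cst.
  by apply: continuous_cvg; [exact: continuous_psiFS|exact: cs].
apply: cvgD; last exact: continuous_d2psiFS.
by apply: continuous_cvg; [exact: continuous_d2psiFS|exact: cs].
Qed.

Lemma integral_right_energy t : 0 <= t ->
  (\int[mu]_(x in `[t, +oo[) (right_energy t x)%:E)%E =
  (t / 4 - ((psi t - psi 0 - t / 2) * (2^-1 + dpsi t) + t / 4 + psi 0 - 2^-1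
     - psi t + dpsi t))%:E.
Proof.
(* The same integration by parts, with [phi' = psi' (x - t)]. The constant [t / 4] makes [G t] equal
   to the integral over [[0, t]], so the limit of [G] at infinity is the total energy. *)
move=> t0; pose G : R -> R := (psi - (psi \o (id - cst t)) - cst (t / 2)) *
    ((dpsi \o (id - cst t)) + dpsi)
  + cst (t / 4) + (psi \o (id - cst t)) - (dpsi \o (id - cst t)) - psi + dpsi.
have dG x : is_derive x 1 G (right_energy t x).
  apply: is_derive_eq; rewrite !fctE /= /right_energy /GRing.scale /=.
  have := dpsiFS_sqr x; have := dpsiFS_sqr (x - t); rewrite !expr2; lra.
have GE x : G x = (psi x - psi (x - t) - t / 2) * (dpsi (x - t) + dpsi x) + t / 4
    + psi (x - t) - dpsi (x - t) - psi x + dpsi x.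
  by rewrite /G !fctE.
have cG : continuous G.
  by move=> x; apply/differentiable_continuous/derivable1_diffP.
have cty : x - t @[x --> +oo] --> +oo.
  exact: cvg_addrr.

rewrite (@ge0_continuous_FTC2y _ (right_energy t) G _ (t / 4)) //.
- by rewrite -EFinB GE subrr dpsiFS0; congr EFin; lra.
- move=> x tx; rewrite mulr_ge0 //.
    by have := flatFS_le x t0; rewrite flatFS_right // subr_ge0.
  by rewrite addr_ge0 // ltW // d2psiFS_gt0.
- by apply: continuous_subspaceT; exact: continuous_right_energy.
(* Both terms diverge; reflection replaces them by [psi] at arguments tending to minus infinity,
   which vanishes in the limit. *)
- have cp : psi (x - t) - psi x @[x --> +oo] --> - t.
    have -> : (fun x => psi (x - t) - psi x) =
        (fun x => psi (- (x - t)) - psi (- x) - t).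
      by apply/funext => x; rewrite !psiFSN; lra.
    rewrite [X in _ --> X](_ : _ = 0 - 0 - t); last by lra.
    apply: cvgB; last exact: cvg_cst.
    apply: cvgB; last exact: cvg_psiFSN.
    exact: cvg_comp cty (@cvg_psiFSN R).
  have cd : dpsi (x - t) @[x --> +oo] --> (1 : R).
    exact: cvg_comp cty (@cvg_dpsiFS R).
  have c1 := @cvg_dpsiFS R.
  have -> : G = fun x => (- (psi (x - t) - psi x) - t / 2) * (dpsi (x - t) + dpsi x)
      + t / 4 + (psi (x - t) - psi x) - dpsi (x - t) + dpsi x.
    by apply/funext => x; rewrite GE; lra.
  rewrite [X in _ --> X](_ : _ =
    (- - t - t / 2) * (1 + 1) + t / 4 + - t - 1 + 1); last by lra.
  apply: cvgD => //; apply: cvgB => //; apply: cvgD => //; apply: cvgD; last exact: cvg_cst.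
  apply: cvgM; last exact: cvgD.
  by apply: cvgB; [exact: cvgN|exact: cvg_cst].
- exact/cvg_at_right_filter/cG.
- by move=> x _; rewrite derive1E derive_val.
Qed.

End Energy.

(** * The K-energy along the geodesic *)

Section KEnergy.
Variable R : realType.
Implicit Types x y t : R.
Local Notation psi := (@psiFS R).
Local Notation dpsi := (@dpsiFS R).
Local Notation d2psi := (@d2psiFS R).
Local Notation mu := (@lebesgue_measure R).

Lemma intX_flatFS t : 0 <= t ->
  intX (fun x => (psi x - flatFS t x) * (curvature t x + d2psi x)) = (t / 4)%:E.
Proof.
move=> t0; set f := fun x => _.
have f0 x : 0 <= f x.
  rewrite mulr_ge0 //; first by rewrite subr_ge0 flatFS_le.
  by rewrite addr_ge0 ?curvature_ge0 // ltW // d2psiFS_gt0.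
have mf : measurable_fun [set: R] f.
  apply: measurable_funM.
    apply: measurable_funB; last exact: measurable_flatFS.
    exact: continuous_measurable_fun (@continuous_psiFS R).
  apply: measurable_funD; first exact: measurable_curvature.
  exact: continuous_measurable_fun (@continuous_d2psiFS R).
have mE (D : set R) : measurable_fun D (EFin \o f).
  by apply/measurable_EFinP; exact: measurable_funS mf.
rewrite /intX.
(* Both break points go to the middle piece, matching the case split of [curvature]. On the left
   piece the two weights coincide. *)
have -> : [set: R] = `]-oo, 0[ `|` (`[0, t] `|` `]t, +oo[).
  apply/seteqP; split=> // x _ /=; rewrite !in_itv /= andbT.
  have [x0|x0] := ltP x 0; first by left.
  by right; have [xt|xt] := leP x t; [left|right].
rewrite ge0_integral_setU //=; last 4 first.
- exact: measurableU.
- exact: mE.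
- by move=> x _; rewrite lee_fin.
- apply/disj_setPS => x [/=]; rewrite !in_itv /= andbT => x0.
  by case => [/andP[]|]; lra.
rewrite ge0_integral_setU //=; last 3 first.
- exact: mE.
- by move=> x _; rewrite lee_fin.
- apply/disj_setPS => x [/=]; rewrite !in_itv /= andbT; lra.
rewrite integral0_eq; last first.
  move=> x /=; rewrite in_itv /= => x0.
  by rewrite /f (flatFS_left t0 (ltW x0)) subrr mul0r.
have -> : (\int[mu]_(x in `[0%R, t]) (f x)%:E =
    \int[mu]_(x in `[0%R, t]) (mid_energy x)%:E)%E.
  apply: eq_integral => x; rewrite inE /= in_itv /= => /andP[x0 xt].
  by rewrite /f /mid_energy flatFS_mid // /curvature x0 xt add0r.
have -> : (\int[mu]_(x in `]t, +oo[) (f x)%:E =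
    \int[mu]_(x in `]t, +oo[) (right_energy t x)%:E)%E.
  apply: eq_integral => x; rewrite inE /= in_itv /= andbT => tx.
  rewrite /f /right_energy (flatFS_right t0 (ltW tx)) /curvature (leNgt x) tx andbF.
  by rewrite (collapse_right t0 (ltW tx)).
rewrite integral_itv_obnd_cbnd; last first.
  apply/measurable_EFinP; apply: (@measurable_funS _ _ _ _ setT) => //.
  exact: continuous_measurable_fun (@continuous_right_energy _ t).
rewrite integral_mid_energy // integral_right_energy // add0e -EFinD.
by congr EFin; lra.
Qed.

(** Let [I] be the integral of [h (phi'' + psi'')]. The energy term, with coefficient
    [Rbar / 2 = 1], is [- I]; the Ricci term and the entropy contribute [2 h psi''] and [2 h phi''],
    together [2 I]. As [h >= 0], signs and sums pass through the integrals without integrability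
    conditions. *)
Lemma Kenergy_flatFS t : 0 <= t -> Kenergy (flatFS t) = (t / 4)%:E.
Proof.
move=> t0; pose h x := psi x - flatFS t x.
have h0 x : 0 <= h x by rewrite subr_ge0 flatFS_le.
have mpsi := continuous_measurable_fun (@continuous_psiFS R).
have md2 := continuous_measurable_fun (@continuous_d2psiFS R).
have mh : measurable_fun [set: R] h.
  by apply: measurable_funB => //; exact: measurable_flatFS.
have mc := measurable_curvature t.
have d20 x : 0 <= d2psi x by rewrite ltW // d2psiFS_gt0.
have m1 : measurable_fun [set: R] (fun x => h x * (curvature t x + d2psi x)).
  by apply: measurable_funM => //; exact: measurable_funD.
have m2 : measurable_fun [set: R] (fun x => 2 * h x * d2psi x).
  by apply: measurable_funM => //; exact: measurable_funM.
have m3 : measurable_fun [set: R] (fun x => 2 * h x * curvature t x).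
  by apply: measurable_funM => //; exact: measurable_funM.
have E1 : Efun (flatFS t) = (- (t / 4))%:E.
  rewrite EFinN -(intX_flatFS t0) /intX -integral_ge0N; last first.
    move=> x _; rewrite lee_fin; apply: mulr_ge0; first exact: h0.
    by rewrite addr_ge0 // curvature_ge0.
  rewrite /Efun (@intX_eq_off2 _ 0 t _ (fun x => - (h x * (curvature t x + d2psi x)))) //.
    exact: measurableT_comp m1.
  by move=> x x0 xt; rewrite d2_flatFS // /h; ring.
have E2 : (- ERicfun (flatFS t) = intX (fun x => 2 * h x * d2psi x)%R)%E.
  rewrite -[RHS]oppeK; congr (- _)%E; rewrite /ERicfun /intX -integral_ge0N.
    by apply: eq_integral => x _; rewrite /ric_density -EFinN /h; congr EFin; ring.
  by move=> x _; rewrite lee_fin !mulr_ge0.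
have E3 : entropy (flatFS t) = intX (fun x => 2 * h x * curvature t x).
  apply: (@intX_eq_off2 _ 0 t) => // x x0 xt; rewrite d2_flatFS //.
  rewrite mulrA [d2psi x * _]mulrC divfK ?gt_eqF ?d2psiFS_gt0 //.
  (* On the flat part both sides vanish. Elsewhere [ln_d2psiFS], applied at [x] and at
     [collapse t x], gives [ln (phi'' / psi'') = 2 h]. *)
  rewrite mulrC /curvature; case: ifPn => [|xn]; first by rewrite !mulr0.
  congr (_ * _); rewrite lnM ?posrE ?invr_gt0 ?d2psiFS_gt0 // lnV ?posrE ?d2psiFS_gt0 //.
  by rewrite !ln_d2psiFS /h; move: xn; case: (collapseP x t0); lra.
rewrite /Kenergy E1 -addeA E2 E3 -ge0_integralD //; last 4 first.
- by move=> x _; rewrite lee_fin !mulr_ge0.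
- exact/measurable_EFinP.
- by move=> x _; rewrite lee_fin !mulr_ge0 // curvature_ge0.
- exact/measurable_EFinP.
rewrite [X in (_ + X)%E](_ : _ = \int[mu]_(x in [set: R])
    (2%:E * (h x * (curvature t x + d2psi x))%R%:E))%E; last first.
  by apply: eq_integral => x _; rewrite -EFinD -EFinM; congr EFin; ring.
rewrite ge0_integralZl_EFin //; last 2 first.
- by move=> x _; rewrite lee_fin mulr_ge0 // addr_ge0 // curvature_ge0.
- exact/measurable_EFinP.
have := intX_flatFS t0; rewrite /intX => ->.
by rewrite /Rbar /dimX -!EFinM -EFinD; congr EFin; lra.
Qed.

End KEnergy.

(** * The geodesic is not induced by automorphisms *)

Section NotPullback.
Variable R : realType.
Implicit Types (w : R[i]) (r : R).
Local Notation psi := (@psiFS R).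

Lemma sqnorm_ge0 w : 0 <= sqnorm w.
Proof. by rewrite /sqnorm addr_ge0 // sqr_ge0. Qed.

Lemma sqnorm_eq0 w : (sqnorm w == 0) = (w == 0).
Proof.
rewrite /sqnorm paddr_eq0 ?sqr_ge0 // !sqrf_eq0.
by case: w => a b; rewrite eq_complex.
Qed.

Lemma sqnormM w1 w2 : sqnorm (w1 * w2) = sqnorm w1 * sqnorm w2.
Proof.
case: w1 w2 => [a b] [c d]; rewrite /sqnorm /=; ring.
Qed.

Lemma sqnorm_div w1 w2 : w2 != 0 -> sqnorm (w1 / w2) = sqnorm w1 / sqnorm w2.
Proof.
move=> w20; apply: (mulIf (x := sqnorm w2)); first by rewrite sqnorm_eq0.
by rewrite -sqnormM !divfK // sqnorm_eq0.
Qed.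

(** The pulled-back Fubini-Study metric is [log (|Z0|^2 + |Z1|^2)], which is polynomial under the
    logarithm. *)
Lemma psiFS_pullback w0 w1 : w0 != 0 -> w1 != 0 ->
  ln (sqnorm w0) + psi (ln (sqnorm (w1 / w0))) = ln (sqnorm w0 + sqnorm w1).
Proof.
move=> w00 w10.
have s0 : 0 < sqnorm w0 by rewrite lt_def sqnorm_eq0 w00 sqnorm_ge0.
have s1 : 0 < sqnorm w1 by rewrite lt_def sqnorm_eq0 w10 sqnorm_ge0.
have s10 : 0 < sqnorm w1 / sqnorm w0 by rewrite divr_gt0.
have s11 : 0 < 1 + sqnorm w1 / sqnorm w0 by rewrite addr_gt0.
rewrite sqnorm_div // /psiFS lnK ?posrE // -lnM ?posrE //.
by congr ln; field; rewrite gt_eqF.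
Qed.

(* [|a + b r|^2] as a real polynomial in the real variable [r]. *)
Definition sqnorm_poly (a b : R[i]) : {poly R} :=
  Poly [:: sqnorm a; 2 * (complex.Re a * complex.Re b + complex.Im a * complex.Im b);
           sqnorm b].

Lemma horner_sqnorm_poly a b r :
  (sqnorm_poly a b).[r] = sqnorm (a + b * r%:C%C).
Proof.
rewrite /sqnorm_poly horner_Poly /= mul0r add0r.
by case: a b => [a1 a2] [b1 b2]; rewrite /sqnorm /=; ring.
Qed.

Lemma size_sqnorm_poly a b : (size (sqnorm_poly a b) <= 3)%N.
Proof. exact: size_Poly. Qed.

Lemma sqnorm_poly_eq0 a b : sqnorm_poly a b = 0 -> a = 0 /\ b = 0.
Proof.
move=> p0.
have c i : (sqnorm_poly a b)`_i = 0 by rewrite p0 coef0.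
have := c 0%N; have := c 2; rewrite !coef_Poly /= => /eqP + /eqP.
by rewrite !sqnorm_eq0 => /eqP -> /eqP ->.
Qed.

Lemma size_mul_bound (p q : {poly R}) m n :
  (size p <= m)%N -> (size q <= n)%N -> (size (p * q)%R <= (m + n).-1)%N.
Proof.
move=> pm qn; apply: leq_trans (size_polyMleq p q) _.
by rewrite -!subn1 leq_sub2r // leq_add.
Qed.

(* On the flat part [x = ln r^2] in [[0, 1]] the metric would satisfy
   [|Z0|^2 + |Z1|^2 = 2 r], an identity between polynomials in the real
   variable [r] that is violated at [r = -1]. *)
Lemma flatFS_not_pullback (A B : 'M[R[i]]_2) : A *m B = 1%:M ->
  ~ pullback_eq A (flatFS 1) psi.
Proof.
move=> AB pb.
(* Invertibility keeps [Z0] and [Z1] from vanishing identically, so [N0] and [N1] are nonzero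
   polynomials. *)
have row_neq0 (i : 'I_2) : ~ (A i 0 = 0 /\ A i 1 = 0).
  move=> [a0 a1]; have := congr1 (fun M : 'M[R[i]]_2 => M i i) AB.
  rewrite !mxE big_ord_recl big_ord1 eqxx /=.
  rewrite (_ : lift ord0 ord0 = 1); last exact: val_inj.
  by rewrite a0 a1 !mul0r addr0 => /esym/eqP; rewrite oner_eq0.
pose N0 := sqnorm_poly (A 0 0) (A 0 1); pose N1 := sqnorm_poly (A 1 0) (A 1 1).
have N00 : N0 != 0 by apply/eqP => /sqnorm_poly_eq0; exact: row_neq0.
have N10 : N1 != 0 by apply/eqP => /sqnorm_poly_eq0; exact: row_neq0.
pose Q := N0 + N1 - 2 *: 'X.
have QE r : Q.[r] = N0.[r] + N1.[r] - 2 * r by rewrite !hornerE.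
have Q0 : Q != 0.
  apply/eqP => /(congr1 (fun p : {poly R} => p.[-1])).
  rewrite QE horner0 !horner_sqnorm_poly.
  have := sqnorm_ge0 (A 0 0 + A 0 1 * (-1)%:C%C).
  have := sqnorm_ge0 (A 1 0 + A 1 1 * (-1)%:C%C); lra.
(* Seven sample points, one more than the degree bound [2 + 2 + 2] of [N0 * N1 * Q]. They lie in
   [[1, 1.3]], so [r^2 <= 2 <= e] and [ln (r^2)] stays in the flat interval [[0, 1]]. *)
pose rs : seq R := [seq 1 + k%:R / 20 | k <- iota 0 7].
have rsP r : r \in rs -> 1 <= r <= 13/10.
  move=> /mapP[k]; rewrite mem_iota add0n /= ltnS => k6 ->.
  have : k%:R <= 6 :> R by rewrite ler_nat.
  have : 0 <= k%:R :> R by [].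
  by lra.
have root_rs : all (root (N0 * N1 * Q)) rs.
  apply/allP => r /rsP /andP[r1 r2]; rewrite !rootM.
  (* The factors [N0] and [N1] absorb the points excluded from [pullback_eq]; at the others the
     pull-back identity forces [Q.[r] = 0]. *)
  have [//|n0] := boolP (root N0 r); have [//|n1] := boolP (root N1 r) => /=.
  have r0 : 0 < r by lra.
  have z0 : r%:C%C != 0 by rewrite eq_complex /= eqxx andbT gt_eqF.
  move: n0 n1; rewrite !rootE QE !horner_sqnorm_poly !sqnorm_eq0 => n0 n1.
  have := pb _ z0 n0 n1; rewrite psiFS_pullback //.
  have -> : sqnorm r%:C%C = r ^+ 2 by rewrite /sqnorm /= expr0n addr0.
  have rr : 1 <= r ^+ 2 <= 2 by rewrite expr2; nra.
  have l0 : 0 <= ln (r ^+ 2) by rewrite ln_ge0 //; case/andP: rr.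
  have l1 : ln (r ^+ 2) <= 1.
    rewrite -ler_expR lnK ?posrE ?exprn_gt0 //.
    have := expR_ge1Dx (1 : R); lra.
  have lh : ln (r ^+ 2) / 2 = ln r by rewrite lnXn //; lra.
  (* The weight at [ln (r^2)] is [ln 2 + ln r], so injectivity of [ln] yields [N0.[r] + N1.[r] = 2
     r]. *)
  rewrite flatFS_mid // lh.
  rewrite /psiFS expR0 -lnM ?posrE // => /ln_inj.
  rewrite !posrE => <-; [by rewrite subrr|by lra|].
  by rewrite addr_gt0 // lt_def sqnorm_ge0 sqnorm_eq0 ?n0 ?n1.
have uniq_rs : uniq rs.
  rewrite map_inj_uniq ?iota_uniq // => i j /addrI /mulIf.
  by rewrite invr_eq0 pnatr_eq0 => /(_ isT) /eqP; rewrite eqr_nat => /eqP.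
have sQ : (size Q <= 3)%N.
  rewrite (leq_trans (size_polyD _ _)) // geq_max size_polyN.
  rewrite (leq_trans (size_polyD _ _)) ?geq_max ?size_sqnorm_poly //=.
  by rewrite (leq_trans (size_scale_leq _ _)) // size_polyX.
have := max_poly_roots _ root_rs uniq_rs.
rewrite !mulf_neq0 // => /(_ isT); rewrite size_map size_iota.
rewrite ltnNge (@size_mul_bound _ _ 5 3) //.
by rewrite (@size_mul_bound _ _ 3 3) // size_sqnorm_poly.
Qed.

End NotPullback.

(** * Assembling the counterexample *)

Theorem theorem1p1 (R : realType) :
  exists phi : R -> R -> R,
    S1_geodesic phi /\
    (exists a b : R, forall t, 0 <= t <= 1 -> Kenergy (phi t) = (a * t + b)%:E) /\
    ~ (exists g : R -> 'M[R[i]]_2, one_param_subgroup g /\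
         forall t, 0 <= t <= 1 -> pullback_eq (g t) (phi t) (phi 0)).
Proof.
exists (@flatFS R); split; [split|split].
- by move=> t /andP[t0 _]; exact: H11_flatFS.
- move=> t y /andP[t0 t1] y01.
  by rewrite !legendre_flatFS //; lra.
- exists 4^-1, 0 => t /andP[t0 _].
  by rewrite Kenergy_flatFS // addr0 mulrC.
- move=> [g [[g0 gD _] pb]].
  (* The contradiction is taken at time [1], where [g (- 1)] is the inverse of [g 1] by the group
     law. *)
  have := pb 1; rewrite ler01 lexx flatFS0 => /(_ isT).
  by apply: (@flatFS_not_pullback _ _ (g (- 1))); rewrite -gD subrr.
Qed.
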